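(* Let $\sim$ be an equivalence relation on $\mathbb{N}$ such that every equivalence class is finite, $\sim$ is computable, and there is an algorithm that given $x$ lists the equivalence class of $x$. Let $0<\gamma<1$. Then there exist an infinite binary sequence $\omega$ that follows $\sim$ and an integer $N$ such that for every finite set $A\subset\mathbb{N}$ with $\#_f A\ge N$ there exists $t\in A$ with $$K(\omega(A)\mid t)\ \ge\ \gamma\cdot\#_f A-K(A\mid t)-\log m(t).$$
   Context: $K(\cdot\mid\cdot)$ denotes conditional prefix Kolmogorov complexity (finite sets, numbers and strings encoded computably); $\log$ is base 2. A binary sequence $\omega$ follows $\sim$ if $\omega_i=\omega_j$ whenever $i\sim j$. For a finite $A\subset\mathbb{N}$, $\omega(A)$ is the binary string of length $\#A$ formed by the bits $\omega_i$, $i\in A$, in increasing order of $i$; $\#_f A$ (the number of free bits in $A$) is the number of equivalence classes of $\sim$ that intersect $A$; and $m(t)$ is the number of elements of the equivalence class of $t$. *)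

(* Defs.v *)
From Stdlib Require Import Reals ClassicalDescription ClassicalEpsilon.
From mathcomp Require Import all_boot.
Set Implicit Arguments. Unset Strict Implicit. Unset Printing Implicit Defensive.

Definition npair (a b : nat) : nat := ((a + b) * (a + b).+1)./2 + b.

Fixpoint unpair (n : nat) : nat * nat :=
  match n with
  | 0 => (0, 0)
  | n'.+1 => let (a, b) := unpair n' in
             if a is a'.+1 then (a', b.+1) else (b.+1, 0)
  end.

Inductive code : Type :=
| CZero | CSucc | CFst | CSnd
| CPair of code & code
| CComp of code & code
| CRec of code & code
| CMu of code.

Fixpoint eval (k : nat) (c : code) (x : nat) {struct k} : option nat :=
  match k with
  | 0 => None
  | k'.+1 =>
    match c with
    | CZero => Some 0
    | CSucc => Some x.+1
    | CFst => Some (unpair x).1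
    | CSnd => Some (unpair x).2
    | CPair f g =>
        match eval k' f x, eval k' g x with
        | Some a, Some b => Some (npair a b)
        | _, _ => None
        end
    | CComp f g =>
        match eval k' g x with Some a => eval k' f a | None => None end
    | CRec f g =>
        let a := (unpair x).1 in
        (fix loop (i : nat) : option nat :=
           match i with
           | 0 => eval k' f a
           | i'.+1 => match loop i' with
                      | Some r => eval k' g (npair a (npair i' r))
                      | None => None
                      end
           end) (unpair x).2
    | CMu f =>
        (fix search (i fuel : nat) {struct fuel} : option nat :=
           match fuel with
           | 0 => None
           | fuel'.+1 =>
               match eval k' f (npair x i) with
               | Some 0 => Some i
               | Some _ => search i.+1 fuel'
               | None => None
               end
           end) 0 k'
    end
  end.

Definition computes (c : code) (x y : nat) : Prop := exists k, eval k c x = Some y.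

(* bijective encoding of binary strings by naturals *)
Fixpoint str2nat (s : seq bool) : nat :=
  if s is b :: s' then (str2nat s').*2 + 1 + b else 0.

(* finite subset of N (given by any list of its elements) encoded canonically *)
Definition setcode (A : seq nat) : nat := \sum_(i <- undup A) 2 ^ i.

Definition runs (U : code) (p : seq bool) (y x : nat) : Prop :=
  computes U (npair (str2nat p) y) x.

Definition prefix_free_machine (U : code) : Prop :=
  forall y p q x x', runs U p y x -> runs U q y x' -> prefix p q -> p = q.

Definition optimal_prefix_machine (U : code) : Prop :=
  prefix_free_machine U /\
  forall V, prefix_free_machine V -> exists c : nat,
    forall p y x, runs V p y x -> exists q, runs U q y x /\ size q <= size p + c.

Definition is_K (U : code) (x y n : nat) : Prop :=
  (exists p, runs U p y x /\ size p = n) /\ (forall p, runs U p y x -> n <= size p).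

(* K_U(x | y); (default 0 if x has no description, which never happens for an
   optimal U) *)
Definition K (U : code) (x y : nat) : nat :=
  match excluded_middle_informative (exists n, is_K U x y n) with
  | left H => proj1_sig (constructive_indefinite_description _ H)
  | right _ => 0
  end.

Definition follows (eqv : nat -> nat -> bool) (omega : nat -> bool) : Prop :=
  forall i j, eqv i j -> omega i = omega j.

Definition restrict (omega : nat -> bool) (A : seq nat) : seq bool :=
  [seq omega i | i <- sort leq (undup A)].

(* #_f A: number of classes meeting A, counted via the least element of A in
   each such class *)
Definition nfree (eqv : nat -> nat -> bool) (A : seq nat) : nat :=
  count (fun i => all (fun j => eqv j i ==> (i <= j)) A) (undup A).

Definition log2 (x : R) : R := Rdiv (ln x) (ln (IZR 2%Z)).

(* Main.v *)
(* The failure of the inequality at every t in A puts (A, omega(A)) into a family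
   of forbidden patterns.  Prefix-freeness of concatenated programs gives
   sum 2^-(K(A|t) + K(Z|t)) <= 1 over the patterns (A, Z) with t in A, so the
   patterns meeting a given class, each of whose m(t) elements contributes at
   most a small multiple of 1/m(t), have small total weight beta^(1 - #_f A) for
   some 2^gamma < beta < 2 when #_f A is large.  Instead of the Lovasz local
   lemma, a counting induction (Rosenfeld) then shows that each new free bit
   multiplies the number of pattern-avoiding assignments by at least beta;
   compactness passes from finitely many free bits to infinitely many. *)
Require Import Defs.
From Stdlib Require Import Reals Lra ClassicalEpsilon.
From mathcomp Require Import all_boot all_order all_algebra.
From mathcomp Require Import boolp Rstruct.
From mathcomp Require Import lra.
Set Implicit Arguments. Unset Strict Implicit. Unset Printing Implicit Defensive.
Import Order.TTheory GRing.Theory Num.Theory.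

(** * Pairing, fuel monotonicity and string codes *)

(** [unpair] walks the antidiagonals one step per successor, in the order in which [npair] numbers
    them; hence the induction on [a + b], then on [b]. *)
Lemma unpair_npair a b : unpair (npair a b) = (a, b).
Proof.
suff H n : forall a b, a + b = n -> unpair (npair a b) = (a, b) by exact: (H _ a b erefl).
have npairS x y : npair x y.+1 = (npair x.+1 y).+1.
  by rewrite /npair addSnnS; exact: addnS.
have npair0 x : npair x.+1 0 = (npair 0 x).+1.
  rewrite /npair !addn0 add0n -addnS.
  have -> : x.+1 * x.+2 = x * x.+1 + x.+1.*2.
    by rewrite -muln2 [x * _]mulnC -mulnDr addn2 mulnC.
  by rewrite halfD odd_double andbF doubleK add0n addnS.
have unpairS m : unpair m.+1 =
    let (x, y) := unpair m in if x is x'.+1 then (x', y.+1) else (y.+1, 0) by [].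
elim: n => [|n IH] {}a {}b.
  by case: a; case: b.
elim: b a => [|b IHb] a.
  by rewrite addn0 => ->; rewrite npair0 unpairS (IH 0 n).
rewrite addnS => -[e]; rewrite npairS unpairS IHb //.
by rewrite addSn e.
Qed.

Lemma eval_mono k c x y : eval k c x = Some y -> eval k.+1 c x = Some y.
Proof.
elim: k c x y => [//|k IH] c x y.
case: c => [||||f g|f g|f g|f] //.
- move=> /=; case Ef: (eval k f x) => [a|] //; case Eg: (eval k g x) => [b|] // e.
  by have /= -> := IH _ _ _ Ef; have /= -> := IH _ _ _ Eg.
- move=> /=; case Eg: (eval k g x) => [a|] // e.
  by have /= -> := IH _ _ _ Eg; exact: (IH _ _ _ e).
- have unfold n : eval n.+1 (CRec f g) x =
      (fix loop (i : nat) : option nat :=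
         match i with
         | 0 => eval n f (unpair x).1
         | i'.+1 => match loop i' with
                    | Some r => eval n g (npair (unpair x).1 (npair i' r))
                    | None => None
                    end
         end) (unpair x).2 by [].
  rewrite !{}unfold; move: (eval k) (eval k.+1) IH => ek ek1 IH.
  elim: (unpair x).2 y => [|i IHi] y; first exact: IH.
  case E: (_ i) => [r|] //; rewrite (IHi _ E); exact: IH.
- have unfold n : eval n.+1 (CMu f) x =
      (fix search (i fuel : nat) {struct fuel} : option nat :=
         match fuel with
         | 0 => None
         | fuel'.+1 =>
             match eval n f (npair x i) with
             | Some 0 => Some i
             | Some _ => search i.+1 fuel'
             | None => None
             end
         end) 0 n by [].
  (* Abstracting the evaluators separates their fuel from the search bound, which is also [k]; the
     induction then runs on the bound alone, for every starting index. *)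
  rewrite !{}unfold; move: (eval k) (eval k.+1) IH => ek ek1 IH.
  elim: k 0 => [//|n IHn] i.
  case E: (ek f _) => [[|r]|] //; rewrite (IH _ _ _ E) //; exact: IHn.
Qed.

Lemma eval_mono_le k k' c x y :
  k <= k' -> eval k c x = Some y -> eval k' c x = Some y.
Proof.
move=> /subnK <- e; elim: (k' - k) => [//|d IH]; rewrite addSn; exact: eval_mono.
Qed.

Lemma computes_fun c x y y' : computes c x y -> computes c x y' -> y = y'.
Proof.
move=> [k Hk] [k' Hk'].
have := eval_mono_le (leq_maxl k k') Hk.
by rewrite (eval_mono_le (leq_maxr k k') Hk') => -[].
Qed.

Lemma str2nat_inj : injective str2nat.
Proof.
elim=> [|b s IH] [|b' s'] //=; rewrite ?addn1 ?addSn // => -[e].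
have eb : b = b'.
  by have := congr1 odd e; rewrite !oddD !odd_double !oddb.
by move: e; rewrite eb => /addIn/double_inj/IH ->.
Qed.

(** * Existence of shortest programs *)

Section Complexity.
Variable (U : code) (HU : optimal_prefix_machine U).

Lemma const_code x : exists c, forall z, computes c z x.
Proof.
elim: x => [|x [c Hc]]; first by exists CZero => z; exists 1.
exists (CComp CSucc c) => z; have [[|k] // Hk] := Hc z.
by exists k.+2; rewrite /= in Hk *; rewrite Hk.
Qed.

(** The tested value does not depend on the search index, so the search stops at once or never: this
    codes a domain test. *)
Lemma computes_search_zero z y :
  computes (CMu (CComp CFst CFst)) z y <-> y = 0 /\ (unpair z).1 = 0.
Proof.
split; last by move=> [-> e]; exists 4; rewrite /= unpair_npair /= e.
case=> -[//|k]; rewrite [eval _ _ _]/=.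
have step i : eval k (CComp CFst CFst) (npair z i) = Some 0 -> (unpair z).1 = 0.
  by case: k => [|[|k]] //=; rewrite unpair_npair => -[].
have [e|ne] := eqVneq (unpair z).1 0.
  have step0 i : k < 2 \/ eval k (CComp CFst CFst) (npair z i) = Some 0.
    by case: (k) => [|[|k']]; [left|left|right; rewrite /= unpair_npair /= e].
  by case: (k) step0 => [|[|k']] // /(_ 0) -[//|->] [<-].
move: (eval k _) step => ev step.
elim: k {1}0 => [//|n IHn] i; case E: (ev _) => [[|r]|] //; last exact: IHn.
by move: ne; rewrite (step _ E).
Qed.

(* The machine that outputs x on the empty program, and diverges on all others,
   makes K(x | y) finite for an optimal U. *)
Lemma is_K_exists x y : exists n, is_K U x y n.
Proof.
have [c Hc] := const_code x.
pose V := CComp c (CMu (CComp CFst CFst)).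
have VP p y' x' : runs V p y' x' -> p = [::].
  rewrite /runs; case=> -[//|k] /=.
  case E: (eval k _ _) => [a|] // _.
  have [_] : a = 0 /\ (unpair (npair (str2nat p) y')).1 = 0.
    by apply/computes_search_zero; exists k.
  by rewrite unpair_npair; exact: (@str2nat_inj p [::]).
have V0 y' : runs V [::] y' x.
  have [k1 H1] : computes (CMu (CComp CFst CFst)) (npair (str2nat [::]) y') 0.
    by apply/computes_search_zero; rewrite unpair_npair.
  have [k2 H2] := Hc 0.
  have H1' := eval_mono_le (leq_maxl k1 k2) H1.
  have H2' := eval_mono_le (leq_maxr k1 k2) H2.
  by exists (maxn k1 k2).+1; rewrite [eval _ _ _]/= H1'.
have PF : prefix_free_machine V.
  by move=> y' p q x1 x2 /VP-> /VP->.
have [c0 /(_ _ _ _ (V0 y)) [q [Hq _]]] := HU.2 V PF.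
pose P n := `[< exists p, runs U p y x /\ size p = n >].
have exP : exists n, P n by exists (size q); apply/asboolP; exists q.
case: (ex_minnP exP) => n /asboolP Pn minn; exists n; split=> // p Hp.
by apply: minn; apply/asboolP; exists p.
Qed.

(** Every number has a program on an optimal machine, so the default value 0 in [K] never occurs. *)
Lemma K_program x y : exists p, runs U p y x /\ size p = K U x y.
Proof.
rewrite /K; case: excluded_middle_informative => [H|[]]; last exact: is_K_exists.
by case: ClassicalEpsilon.constructive_indefinite_description => n [].
Qed.

End Complexity.

(** * The Kraft inequality *)

(** Pad each codeword to the common length [n] in all possible ways: by prefix-freeness these blocks
    are disjoint, and together they fit into the [2 ^ n] strings of length [n]. *)
Lemma kraft (F : realFieldType) (s : seq (seq bool)) :
  uniq s -> {in s &, forall p q, prefix p q -> p = q} ->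
  (\sum_(p <- s) 2^-1 ^+ size p <= 1 :> F)%R.
Proof.
move=> us pf.
pose n := \max_(p <- s) size p.
have le_n p : p \in s -> size p <= n.
  by move=> ps; rewrite /n (leq_bigmax_seq (F := size)).
pose strings k := [seq val t | t <- enum {: k.-tuple bool}].
have stringsP k t : (t \in strings k) = (size t == k).
  apply/mapP/idP => [[u _ ->]|st]; first exact/eqP/size_tuple.
  by exists (Tuple st); rewrite ?mem_enum.
have size_strings k : size (strings k) = 2 ^ k.
  by rewrite size_map -cardE card_tuple card_bool.
pose L := [seq p ++ t | p <- s, t <- strings (n - size p)].
have uL : uniq L.
  apply: allpairs_uniq_dep => // [p _|].
    by rewrite map_inj_uniq ?enum_uniq //; exact: val_inj.
  move=> [p t] [p' t'] /allpairsPdep[p1 [t1 [ps _ [e1 e2]]]].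
  move=> /allpairsPdep[p2 [t2 [ps' _ [e3 e4]]]] /= e.
  subst.
  have epp : p1 = p2.
    have [le12|lt21] := leqP (size p1) (size p2).
      by apply: (pf _ _ ps ps'); rewrite prefixE -(takel_cat t2 le12) -e take_size_cat.
    apply/esym/(pf _ _ ps' ps); rewrite prefixE.
    by rewrite -(takel_cat t1 (ltnW lt21)) e take_size_cat.
  by move: e; rewrite epp => /eqP; rewrite eqseq_cat // eqxx => /eqP ->.
have sL : size L <= 2 ^ n.
  rewrite -size_strings; apply: uniq_leq_size => // _ /allpairsPdep[p [t [ps ts ->]]].
  move: ts; rewrite !stringsP size_cat => /eqP ->.
  by rewrite subnKC // le_n.
have eL : size L = \sum_(p <- s) 2 ^ (n - size p).
  rewrite size_allpairs_dep sumnE big_map.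
  by apply: eq_bigr => p _; rewrite size_strings.
have pos : (0 < (2 : F) ^+ n)%R by rewrite exprn_gt0 // ltr0n.
rewrite -(ler_pM2l pos) mulr1 mulr_sumr.
have -> : (\sum_(p <- s) (2 : F) ^+ n * 2^-1 ^+ size p = (size L)%:R)%R.
  rewrite eL natr_sum; apply: eq_big_seq => p ps.
  rewrite natrX -[in LHS](subnK (le_n _ ps)) exprD exprVn mulfK //.
  by rewrite expf_neq0 // pnatr_eq0.
by rewrite -natrX ler_nat.
Qed.

(** * Counting assignments that avoid forbidden patterns *)

Section Counting.
Variables (F : realFieldType) (T : finType).
Variables (Fb : {set {set T} * {set T}}) (beta : F).

(* A set s stands for a bit assignment; (B, D) forbids the trace D on B. *)
Definition avoiding (W : {set T}) : {set {set T}} :=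
  [set s : {set T} | (s \subset W) &&
    [forall c in Fb, (c.1 \subset W) ==> (s :&: c.1 != c.2)]].

Hypothesis beta_gt0 : (0 < beta)%R.
(** A new bit doubles the assignments, and the patterns through [v] may destroy at most the share
    [2 - beta], which leaves a factor [beta]. The exponent omits [v], because only the other points
    of a pattern are present before [v] is added. *)
Hypothesis weight : forall v,
  (\sum_(c in Fb | v \in c.1) beta ^- #|c.1|.-1 <= 2 - beta)%R.

Local Open Scope ring_scope.

(* An extension of an avoiding s \subset W to v |: W is bad only through some
   pattern c with v \in c.1; such extensions are determined by their trace on
   W :\: c.1, whose avoiding sets are, by induction, fewer than those of W by a
   factor beta ^+ #|c.1|.-1. *)
Lemma card_avoiding_setU1 (W : {set T}) v :
  v \notin W -> beta * #|avoiding W|%:R <= #|avoiding (v |: W)|%:R.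
Proof.
have [n] := ubnP #|W|; elim: n W v => // n IH W v leWn vW.
(* Adding the points of [W :\: X] one at a time uses the induction hypothesis only on sets smaller
   than [W]. *)
have mono k (X : {set T}) : X \subset W -> #|W :\: X| = k ->
    beta ^+ k * #|avoiding X|%:R <= #|avoiding W|%:R.
  elim: k X => [|k IHk] X XW.
    move/eqP; rewrite cards_eq0 setD_eq0 => WX.
    by rewrite expr0 mul1r (_ : X = W) //; apply/eqP; rewrite eqEsubset XW.
  move=> cWX; have [x] : exists x, x \in W :\: X.
    by apply/set0Pn; rewrite -cards_eq0 cWX.
  rewrite inE => /andP[xX xW].
  have cX1 : #|W :\: (x |: X)| = k.
    have := cardsD1 x (W :\: X); rewrite cWX !inE xX xW add1n => -[->].
    by congr #|pred_of_set _|; apply/setP => z; rewrite !inE negb_or andbA.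
  have XsW : (x |: X) \subset W by rewrite subUset sub1set xW.
  apply: le_trans (IHk _ XsW cX1).
  rewrite exprSr -mulrA ler_pM2l ?exprn_gt0 // IH //.
  apply: leq_trans (_ : #|W| <= n)%N => //; apply: proper_card.
  by apply/properP; split=> //; exists x.
(* All extensions of avoiding sets by a free choice at [v]; there are twice as many. *)
pose Ext := [set s : {set T} | (s \subset v |: W) && (s :\ v \in avoiding W)].
have cExt : #|Ext| = (2 * #|avoiding W|)%N.
  have -> : Ext = avoiding W :|: [set v |: s | s in avoiding W].
    apply/setP => s; apply/idP/idP.
      rewrite inE => /andP[sW sA]; have [vs|vs] := boolP (v \in s).
        rewrite in_setU; apply/orP; right; apply/imsetP.
        by exists (s :\ v); rewrite // setD1K.
      rewrite in_setU; apply/orP; left; rewrite (_ : s = s :\ v) //.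
      by apply/setP => z; rewrite !inE; case: eqP => // ->; apply: negbTE.
    have sub s' : s' \in avoiding W -> (s' \subset W) by rewrite inE => /andP[].
    have Dv (s' : {set T}) : s' \subset W -> s' :\ v = s'.
      move=> s'W; apply/setP => z; rewrite !inE; case: eqP => // ->.
      by apply/esym/negbTE/(contra _ vW) => /(subsetP s'W).
    rewrite in_setU => /orP[sA|/imsetP[s' sA ->]].
      by rewrite inE Dv ?sub // sA andbT (subset_trans (sub _ sA)) ?subsetUr.
    have s'W := sub _ sA.
    rewrite inE setUS // setU1K ?sA //.
    by apply/(contra _ vW) => /(subsetP s'W).
  have sub s' : s' \in avoiding W -> v \notin s'.
    by rewrite inE => /andP[s'W _]; apply/(contra _ vW) => /(subsetP s'W).
  rewrite cardsU (_ : _ :&: _ = set0).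
    rewrite cards0 subn0 card_in_imset ?mul2n -?addnn // => s s' /sub vs /sub vs' e.
    by rewrite -(setU1K vs) e setU1K.
  apply/setP => s; rewrite !inE; apply/negP => /andP[sW /imsetP[s' _ es]].
  by have := sub s; rewrite inE sW es setU11 => /(_ isT).
(* A pattern without [v] that an extension shows is already shown by its trace on [W], so only these
   can spoil an extension. *)
pose C := [set c in Fb | (v \in c.1) && (c.1 \subset v |: W)].
have cC : (#|Ext :\: avoiding (v |: W)| <=
           \sum_(c in C) #|[set s in Ext | s :&: c.1 == c.2]|)%N.
  apply: leq_trans (_ : #|\bigcup_(c in C) [set s in Ext | s :&: c.1 == c.2]| <= _)%N;
    last first.
    by elim/big_ind2: _ => // [|m1 X m2 Y h1 h2]; rewrite ?cards0 //;
       rewrite (leq_trans (leq_card_setU _ _)) // leq_add.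
  apply/subset_leq_card/subsetP => s; rewrite inE => /andP[+ sE].
  have := sE; rewrite 2!inE => /andP[sW sDW] sav.
  have {sav} : ~~ [forall c in Fb, (c.1 \subset v |: W) ==> (s :&: c.1 != c.2)].
    by move: sav; rewrite inE sW.
  rewrite negb_forall => /existsP[c]; rewrite !negb_imply andbT => /and3P[cF cW sc].
  apply/bigcupP; exists c; last by rewrite inE sE.
  rewrite inE cF cW andbT /=; apply/negPn/negP => vc.
  move: sDW => /andP[_ /forall_inP/(_ c cF)/implyP]; case/(_ _)/negP.
    apply/subsetP => z zc; have := subsetP cW z zc; rewrite !inE => /orP[/eqP ez|//].
    by rewrite -ez zc in vc.
  rewrite -(eqP sc); apply/eqP/setP => z; rewrite !inE.
  by case: eqVneq => // ->; rewrite (negbTE vc) !andbF.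
have cc c : c \in C -> #|[set s in Ext | s :&: c.1 == c.2]|%:R <=
    #|avoiding W|%:R * beta ^- #|c.1|.-1.
  rewrite inE => /and3P[cF vc cW].
  have cD : #|W :\: (W :\: c.1)| = #|c.1|.-1.
    rewrite (cardsD1 v c.1) vc /=; congr #|pred_of_set _|; apply/setP => z.
    rewrite !inE; have := subsetP cW z; rewrite !inE.
    case: eqVneq => [->|_] /=; first by rewrite (negbTE vW) andbF.
    by case: (z \in c.1) => // [->|]; rewrite ?andbF ?andNb.
  rewrite ler_pdivlMr ?exprn_gt0 // mulrC.
  apply: le_trans (mono _ (W :\: c.1) (subsetDl _ _) cD).
  rewrite ler_pM2l ?exprn_gt0 // ler_nat.
  rewrite -(card_in_imset (f := fun s => s :\: c.1)); last first.
    move=> s s'; rewrite !inE => /andP[_ /eqP e] /andP[_ /eqP e'] ee.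
    by rewrite -(setID s c.1) e ee -e' setID.
  apply/subset_leq_card/subsetP => _ /imsetP[s + ->].
  rewrite 3!inE => /andP[/andP[sW /andP[sDW /forall_inP av]] _].
  rewrite inE; apply/andP; split.
    apply/subsetP => z; rewrite !inE => /andP[zc zs]; rewrite zc /=.
    by have := subsetP sW z zs; rewrite !inE => /orP[/eqP ez|//]; rewrite ez vc in zc.
  apply/forall_inP => d dF; apply/implyP => dW.
  have dW' := subset_trans dW (subsetDl _ _).
  have := av d dF; rewrite dW' /=; apply: contra => /eqP <-; apply/eqP/setP => z.
  rewrite !inE; have [zd|] := boolP (z \in d.1); last by rewrite !andbF.
  have := subsetP dW z zd; rewrite !inE => /andP[-> zW].
  by rewrite (_ : z != v) //; apply: contraNneq vW => <-.
have cE : (#|Ext| <= #|avoiding (v |: W)| + #|Ext :\: avoiding (v |: W)|)%N.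
  by rewrite -(cardsID (avoiding (v |: W)) Ext) leq_add2r subset_leq_card // subsetIr.
have {cE cC} : (2 * #|avoiding W|%:R : F) <= #|avoiding (v |: W)|%:R +
     \sum_(c in C) #|avoiding W|%:R * beta ^- #|c.1|.-1.
  rewrite -natrM -cExt; apply: le_trans (_ : (_ + _)%:R <= _).
    by rewrite ler_nat; exact: (leq_trans cE (leq_add (leqnn _) cC)).
  by rewrite natrD lerD2l natr_sum ler_sum.
have : \sum_(c in C) beta ^- #|c.1|.-1 <= 2 - beta.
  apply: le_trans (weight v); rewrite [leRHS]big_mkcond [leLHS]big_mkcond.
  rewrite ler_sum // => c _.
  rewrite inE; case: (c \in Fb) => //=; case: (v \in c.1) => //=; case: ifP => // _.
  by rewrite invr_ge0 exprn_ge0 // ltW.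
(* With A, X the two counts: 2A <= X + A S, S <= 2 - beta and A >= 0 give beta A <= X. *)
rewrite -mulr_sumr; move: (\sum_(c in C) _) (ler0n F #|avoiding W|) => S A0 SB.
nra.
Qed.

(** Growing [W] point by point from the empty set keeps the count positive; it starts positive
    because no nonempty pattern fits into the empty set. *)
Lemma avoiding_exists : (forall c, c \in Fb -> c.1 != set0) ->
  exists s : {set T}, forall c, c \in Fb -> s :&: c.1 != c.2.
Proof.
move=> ne0.
have pos n (W : {set T}) : #|W| = n -> (0 < #|avoiding W|)%N.
  elim: n W => [|n IH] W.
    move/eqP; rewrite cards_eq0 => /eqP ->; apply/card_gt0P; exists set0.
    rewrite inE sub0set; apply/forall_inP => c /ne0 c0.
    by rewrite subset0 (negbTE c0).
  move=> cW; have [v vW] : exists v, v \in W by apply/set0Pn; rewrite -cards_eq0 cW.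
  have := @card_avoiding_setU1 (W :\ v) v; rewrite setD11 setD1K // => /(_ isT).
  have : (0 < #|avoiding (W :\ v)|)%N.
    by apply: IH; apply: succn_inj; rewrite -cW (cardsD1 v W) vW.
  rewrite -!(ltr0n F) => h; apply: lt_le_trans; exact: mulr_gt0.
have /card_gt0P[s] := pos _ setT erefl.
rewrite inE => /andP[_ /forall_inP H]; exists s => c /H.
by rewrite subsetT.
Qed.
End Counting.

(** * Passage to infinitely many bits *)

(** A path through a binary tree, as in König's lemma: a prefix is kept while the witnesses [f M']
    that extend it have unbounded [M']. By the first hypothesis such a witness with [M' >= M]
    settles [P M] from [M] bits. *)
Lemma compactness (P : nat -> (nat -> bool) -> Prop) :
  (forall M w w', (forall i, i < M -> w i = w' i) -> P M w -> P M w') ->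
  (forall M, exists w, forall m, m <= M -> P m w) ->
  exists w, forall M, P M w.
Proof.
move=> ext /boolp.choice[f fP].
pose good (s : seq bool) := forall M, exists2 M', M <= M' &
  forall j, j < size s -> f M' j = nth false s j.
have step (s : {s | good s}) : exists b, good (rcons (sval s) b).
  (* If both one-bit extensions were dead, beyond [M1] and [M2], a witness past both bounds would
     still choose one of the two bits. *)
  case: s => s gs /=; apply: contrapT => /forallNP H.
  have /existsNP[M1 H1] := H true.
  have /existsNP[M2 H2] := H false.
  have [M' leM agree] := gs (maxn M1 M2).
  have agree' j : j < size (rcons s (f M' (size s))) ->
      f M' j = nth false (rcons s (f M' (size s))) j.
    rewrite size_rcons nth_rcons ltnS leq_eqVlt => /orP[/eqP ->|lt].
      by rewrite ltnn eqxx.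
    by rewrite lt agree.
  move: leM; rewrite geq_max => /andP[le1 le2].
  by case: (f M' (size s)) agree' => agree'; [apply: H1 | apply: H2]; exists M'.
have /boolp.choice[nxt nxtP] := step.
have good0 : good [::] by move=> M; exists M.
pose s := fix s n : {s | good s} :=
  if n is n'.+1 then exist _ _ (nxtP (s n')) else exist _ _ good0.
have size_s n : size (sval (s n)) = n by elim: n => //= n IH; rewrite size_rcons IH.
pose w n := nth false (sval (s n.+1)) n.
have nth_s n j : j < n -> nth false (sval (s n)) j = w j.
  elim: n => // n IH; rewrite ltnS leq_eqVlt => /orP[/eqP ->//|lt].
  by rewrite /= nth_rcons size_s lt IH.
exists w => M; have [M' leM agree] := svalP (s M) M.
apply: (ext _ (f M')); last exact: fP.
by move=> i ltM; rewrite agree ?size_s // nth_s.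
Qed.

(** * Codes of sets and restrictions *)

(** The code is the binary number whose digit [i] is the membership of [i], and binary digits are
    unique. *)
Lemma setcode_inj A B : setcode A = setcode B -> A =i B.
Proof.
have digits n (f g : nat -> bool) :
    \sum_(i < n) f i * 2 ^ i = \sum_(i < n) g i * 2 ^ i -> forall i, i < n -> f i = g i.
  elim: n f g => // n IH f g; rewrite !big_ord_recl /= !expn0 !muln1.
  have E (h : nat -> bool) : \sum_(i < n) h (bump 0 i) * 2 ^ bump 0 i =
      (\sum_(i < n) h i.+1 * 2 ^ i).*2.
    by rewrite -mul2n big_distrr /=; apply: eq_bigr => i _; rewrite expnS mulnCA.
  rewrite !E => e.
  have e0 : f 0 = g 0 by have := congr1 odd e; rewrite !oddD !odd_double !addbF !oddb.
  move: e; rewrite e0 => /addnI/double_inj/(IH (f \o S) (g \o S)) H [|i] //; exact: H.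
(* A common bound, so that both codes become digit sums over one range. *)
pose n := (\max_(i <- A ++ B) i).+1.
have expand (C : seq nat) : {subset C <= A ++ B} ->
      setcode C = \sum_(i < n) (val i \in C) * 2 ^ i.
  move=> CAB; rewrite -(big_mkord xpredT (fun i => (i \in C) * 2 ^ i)).
  rewrite (eq_bigr (fun i => if i \in C then 2 ^ i else 0)); last first.
    by move=> i _; case: (i \in C); rewrite ?mul1n.
  rewrite -big_mkcond -big_filter; apply: perm_big; apply: uniq_perm.
  - exact: undup_uniq.
  - exact/filter_uniq/iota_uniq.
  move=> i; rewrite mem_undup mem_filter mem_index_iota /=.
  case: (boolP (i \in C)) => // /CAB iAB; apply/esym.
  by rewrite ltnS (leq_bigmax_seq (F := id)).
rewrite !expand; try by move=> i iC; rewrite mem_cat iC ?orbT.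
move=> /digits H i; have [ltin|gein] := ltnP i n; first exact: (H i ltin).
have notin : i \notin A ++ B.
  apply/negP => iAB; move: gein; rewrite ltnNge.
  by rewrite (leq_bigmax_seq (F := id)).
by move: notin; rewrite mem_cat negb_or => /andP[/negbTE -> /negbTE ->].
Qed.

Lemma restrict_eq w w' A :
  restrict w A = restrict w' A <-> {in A, w =1 w'}.
Proof.
rewrite /restrict; split=> [/eq_in_map H a aA|H].
  by apply: H; rewrite mem_sort mem_undup.
by apply/eq_in_map => a; rewrite mem_sort mem_undup; exact: H.
Qed.

Lemma eq_mem_restrict w A B : A =i B -> restrict w A = restrict w B.
Proof.
move=> AB; congr map; apply/perm_sortP; rewrite ?uniq_perm ?undup_uniq //.
- exact: leq_total.
- exact: leq_trans.
- exact: anti_leq.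
by move=> i; rewrite !mem_undup.
Qed.

(** * The Kraft inequality for pairs of complexities *)

Section KraftK.
Variables (U : code) (HU : optimal_prefix_machine U).

(* Concatenating a program for x with a program for z gives a prefix-free
   family indexed by the pairs (x, z). *)
Lemma kraft_K_pair (F : realFieldType) t (L : seq (nat * nat)) : uniq L ->
  (\sum_(xz <- L) 2^-1 ^+ (K U xz.1 t + K U xz.2 t) <= 1 :> F)%R.
Proof.
move=> uL.
have /boolp.choice[p pP] := K_program HU ^~ t.
have p_eq x z : prefix (p x) (p z) -> x = z.
  move=> /(HU.1 _ _ _ _ _ (pP x).1 (pP z).1) e.
  by have := (pP x).1; rewrite e => /computes_fun; apply; exact: (pP z).1.
have cmp (u u' v v' : seq bool) :
    prefix (u ++ v) (u' ++ v') -> prefix u u' \/ prefix u' u.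
  move=> /prefixP[r]; rewrite -catA => e.
  have [le|lt] := leqP (size u) (size u'); [left|right]; rewrite prefixE.
    by rewrite -(takel_cat v' le) e take_size_cat.
  by rewrite -(takel_cat (v ++ r) (ltnW lt)) -e take_size_cat.
pose cat2 xz := p xz.1 ++ p xz.2.
have cat2P xz xz' : prefix (cat2 xz) (cat2 xz') -> xz = xz'.
  case: xz xz' => [x z] [x' z'] H; have ex : x = x'.
    by case: (cmp _ _ _ _ H) => [/(p_eq x x')|/(p_eq x' x)].
  move: H; rewrite ex /cat2 /= prefix_catr // eqxx.
  by move=> /p_eq ->.
have := @kraft F [seq cat2 xz | xz <- L].
rewrite map_inj_uniq ?uL; last by move=> a b e; apply: cat2P; rewrite e prefix_refl.
move=> /(_ isT); rewrite big_map => H.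
have sizeE xz : K U xz.1 t + K U xz.2 t = size (cat2 xz).
  by rewrite size_cat (pP xz.1).2 (pP xz.2).2.
under eq_bigr => xz _ do rewrite sizeE.
by apply: H => _ _ /mapP[a _ ->] /mapP[b _ ->] /cat2P ->.
Qed.
End KraftK.

(* With q = 2^gamma, the failure of the theorem's inequality in exponential form. *)
Lemma lt_bound_exp gamma k a m n : 0 < m ->
  ~ Rge (INR k) (Rminus (Rminus (Rmult gamma (INR n)) (INR a)) (log2 (INR m))) ->
  (2 ^+ (k + a) * m%:R < (exp (Rmult gamma (ln 2))) ^+ n :> R)%R.
Proof.
move=> m0 /Rnot_ge_lt H.
have ln2 : Rlt 0 (ln 2) by rewrite -ln_1; apply: ln_increasing; Lra.lra.
have m0' : Rlt 0 (INR m) by apply: lt_0_INR; apply/ssrnat.ltP.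
apply/RltP; rewrite -[m%:R%R]INRE -!RpowE.
have two : (2%:R : R)%R = IZR 2 by rewrite -INRE.
rewrite two.
have p2 : Rlt 0 (pow (IZR 2) (k + a)) by apply: pow_lt; Lra.lra.
apply: ln_lt_inv.
- exact: Rmult_lt_0_compat.
- apply: pow_lt; exact: exp_pos.
rewrite ln_mult // !ln_pow; [|exact: exp_pos|Lra.lra].
rewrite ln_exp plus_INR.
have e : Rmult (log2 (INR m)) (ln 2) = ln (INR m).
  by rewrite /log2 /Rdiv Rmult_assoc Rinv_l ?Rmult_1_r //; Lra.lra.
have := Rmult_lt_compat_r _ _ _ ln2 H.
Lra.lra.
Qed.

(** * Free bits and forbidden patterns *)

Section Patterns.
Variables (eqv : nat -> nat -> bool) (cls : nat -> seq nat).
Hypotheses (eqv_refl : forall x, eqv x x)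
  (eqv_sym : forall x y, eqv x y = eqv y x)
  (eqv_trans : forall x y z, eqv x y -> eqv y z -> eqv x z)
  (cls_spec : forall x y, (y \in cls x) = eqv x y).

(** Free bits are indexed by the least elements of their classes, so [w \o rep] follows the relation
    for every [w]. *)
Definition rep (x : nat) : nat := ex_minn (ex_intro (eqv x) x (eqv_refl x)).

Lemma eqv_rep x : eqv x (rep x).
Proof. by rewrite /rep; case: ex_minnP. Qed.

Lemma rep_le x y : eqv x y -> rep x <= y.
Proof. by rewrite /rep; case: ex_minnP => m _ H /H. Qed.

Lemma eqvE x y : eqv x y = (rep x == rep y).
Proof.
apply/idP/eqP => [exy|e]; last first.
  by apply: eqv_trans (eqv_rep x) _; rewrite e eqv_sym eqv_rep.
have exy' : eqv y x by rewrite eqv_sym.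
apply/anti_leq; rewrite !rep_le //.
- exact: eqv_trans exy' (eqv_rep x).
- exact: eqv_trans exy (eqv_rep y).
Qed.

Lemma size_cls x y : eqv x y -> size (undup (cls x)) = size (undup (cls y)).
Proof.
move=> exy; apply/perm_size/uniq_perm; rewrite ?undup_uniq // => z.
rewrite !mem_undup !cls_spec; apply/idP/idP; last exact: eqv_trans.
by apply: eqv_trans; rewrite eqv_sym.
Qed.

(** [nfree] counts least elements within [A], which need not be least in their classes; [rep]
    matches them with the representatives of the classes met. *)
Lemma nfree_rep A : nfree eqv A = size (undup (map rep A)).
Proof.
rewrite /nfree -size_filter -(size_map rep); apply/perm_size/uniq_perm.
- rewrite map_inj_in_uniq ?filter_uniq ?undup_uniq // => i j.
  rewrite !mem_filter !mem_undup => /andP[/allP mi iA] /andP[/allP mj jA] /eqP.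
  rewrite -eqvE => eij; apply/anti_leq.
  by rewrite (implyP (mi _ jA)) ?(implyP (mj _ iA)) // eqv_sym.
- exact: undup_uniq.
move=> r; rewrite mem_undup; apply/mapP/mapP => -[a].
  by rewrite mem_filter mem_undup => /andP[_ aA] ->; exists a.
move=> aA ->.
have exP : exists i, (i \in A) && eqv i a by exists a; rewrite aA eqv_refl.
case: (ex_minnP exP) => i /andP[iA eia] mini; exists i.
  rewrite mem_filter mem_undup iA andbT; apply/allP => j jA; apply/implyP => eji.
  by apply: mini; rewrite jA (eqv_trans eji).
by apply/esym/eqP; rewrite -eqvE.
Qed.

Definition support M (A : seq nat) : {set 'I_M} := [set i | val i \in map rep A].

Lemma card_support M A : (forall a, a \in A -> rep a < M) ->
  #|support M A| = nfree eqv A.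
Proof.
move=> lt; rewrite nfree_rep cardE -(size_map val); apply/perm_size/uniq_perm.
- by rewrite map_inj_uniq ?enum_uniq //; exact: val_inj.
- exact: undup_uniq.
move=> r; rewrite mem_undup; apply/mapP/idP => [[i]|].
  by rewrite mem_enum inE => iA ->.
move=> rA; have [a aA er] := mapP rA; have ltr : r < M by rewrite er lt.
by exists (Ordinal ltr); rewrite // mem_enum inE.
Qed.

(** A set of ordinals read as a sequence of free bits, [false] from [M] on. *)
Definition bits M (s : {set 'I_M}) (x : nat) : bool := [exists i in s, val i == x].

Lemma bitsE M (s : {set 'I_M}) (i : 'I_M) : bits s i = (i \in s).
Proof.
apply/exists_inP/idP => [[j js /eqP/val_inj <-] //|is_]; by exists i.
Qed.

(** The case of [M] free bits. A forbidden [A] with n free bits satisfies 2^k m < q^n at each [t], k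
    being the sum of the two complexities, so its weight beta^(1-n) is at most (e/m) 2^-k with e =
    beta (q/beta)^(N+1). Kraft's inequality sums this to at most e/m for each [t], hence to at most
    e over the m elements of a class. *)
Lemma avoid_bounded (F : realFieldType) (U : code) (HU : optimal_prefix_machine U)
    (q beta : F) N M :
  (0 < q)%R -> (q < beta)%R -> (beta * (q / beta) ^+ N.+1 <= 2 - beta)%R ->
  exists w : nat -> bool, forall A, (forall a, a \in A -> rep a < M) ->
    N < nfree eqv A ->
    ~ (forall t, t \in A ->
        2 ^+ (K U (str2nat (restrict (w \o rep) A)) t + K U (setcode A) t)
          * (size (undup (cls t)))%:R < q ^+ nfree eqv A)%R.
Proof.
move=> q0 qb bN.
pose bad A w := N < nfree eqv A /\ (forall t, t \in A ->
        2 ^+ (K U (str2nat (restrict (w \o rep) A)) t + K U (setcode A) t)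
          * (size (undup (cls t)))%:R < q ^+ nfree eqv A)%R.
pose Q (c : {set 'I_M} * {set 'I_M}) A :=
  [/\ forall a, a \in A -> rep a < M, c.1 = support M A, c.2 \subset c.1 &
      bad A (bits c.2)].
pose Fb := [set c | `[< exists A, Q c A >]].
(* Several [A] may yield the same pattern; one is fixed per pattern, so that each pattern has a
   single pair of codes. *)
have /boolp.choice[Ac AcP] c : exists A, c \in Fb -> Q c A.
  have [|] := boolP (c \in Fb); last by exists [::].
  by rewrite inE => /asboolP[A QA]; exists A.
have beta0 : (0 < beta)%R by exact: lt_trans q0 qb.
have sz v : 0 < size (undup (cls v)).
  by rewrite lt0n size_eq0; apply/eqP => e; have := cls_spec v v;
     rewrite -mem_undup e eqv_refl.
pose pat c := (setcode (Ac c), str2nat (restrict (bits c.2 \o rep) (Ac c))).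
(* The set code determines the support; the string then determines the trace, since each bit of the
   support is read at some element of the set. *)
have pat_inj : {in Fb &, injective pat}.
  move=> c d /AcP[lt c1 c21 _] /AcP[lt' d1 d21 _] [/setcode_inj eA /str2nat_inj].
  rewrite -(eq_mem_restrict _ eA) => /restrict_eq e.
  have e1 : c.1 = d.1.
    by rewrite c1 d1; apply/setP => i; rewrite !inE (eq_mem_map rep eA).
  have e2 : c.2 = d.2.
    apply/setP => i; have [ic|ic] := boolP (i \in c.1); last first.
      rewrite (negbTE (contra (subsetP c21 i) ic)).
      by rewrite e1 in ic; rewrite (negbTE (contra (subsetP d21 i) ic)).
    move: (ic); rewrite c1 inE => /mapP[a aA ei].
    by rewrite -!bitsE ei; exact: e.
  by case: c d e1 e2 {lt c1 c21 lt' d1 d21 eA e} => ? ? [? ?] /= -> ->.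
pose g s c : F := (2^-1 ^+ (K U (pat c).1 s + K U (pat c).2 s))%R.
have g0 s c : (0 <= g s c)%R by rewrite exprn_ge0 // invr_ge0 ler0n.
have kraft_s s : (\sum_(c in Fb | s \in Ac c) g s c <= 1)%R.
  rewrite -big_filter.
  have := @kraft_K_pair U HU F s
    (map pat [seq c <- index_enum _ | (c \in Fb) && (s \in Ac c)]).
  rewrite big_map; apply; rewrite map_inj_in_uniq ?filter_uniq ?index_enum_uniq // => c d.
  by rewrite !mem_filter => /andP[/andP[cF _] _] /andP[/andP[dF _] _]; exact: pat_inj.
pose e := (beta * (q / beta) ^+ N.+1)%R.
have e0 : (0 <= e)%R.
  by rewrite mulr_ge0 ?ltW // exprn_gt0 // divr_gt0.
have bound c s : c \in Fb -> s \in Ac c ->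
    (beta ^- #|c.1|.-1 <= e / (size (undup (cls s)))%:R * g s c)%R.
  move=> /AcP[lt c1 _ [Nn H]] sA.
  have := H s sA; rewrite c1 card_support //.
  set k := (_ + _)%N; set m : F := (size (undup (cls s)))%:R%R.
  case: (nfree eqv (Ac c)) Nn => // n; rewrite ltnS => Nn kmq.
  have m0 : (0 < m)%R by rewrite ltr0n.
  have k0 : (0 < (2 : F) ^+ k)%R by rewrite exprn_gt0 // ltr0n.
  have n0 : (0 < beta ^+ n)%R by rewrite exprn_gt0.
  have r0 : (0 <= q / beta <= 1)%R.
    by apply/andP; split; [rewrite divr_ge0 // ltW | rewrite ler_pdivrMr // mul1r ltW].
  (* The left side equals beta (q/beta)^(n+1), which decreases in n since q < beta, and [N <= n]. *)
  have en : (q ^+ n.+1 / beta ^+ n <= e)%R.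
    apply: le_trans (_ : beta * (q / beta) ^+ n.+1 <= _)%R.
      by rewrite expr_div_n [(beta ^+ n.+1)%R]exprS invfM mulrCA mulVKf ?gt_eqF.
    by have /andP[? ?] := r0; rewrite /e ler_pM2l // ler_wiXn2l.
  have -> : g s c = (2 ^- k)%R by rewrite /g exprVn addnC.
  rewrite -mulrA -invfM ler_pdivlMr ?mulr_gt0 //; apply: le_trans en.
  by rewrite mulrC ler_pM2r ?invr_gt0 // mulrC ltW.
have weight v : (\sum_(c in Fb | v \in c.1) beta ^- #|c.1|.-1 <= 2 - beta)%R.
  apply: le_trans bN; rewrite -/e.
  pose m : F := ((size (undup (cls v)))%:R)%R.
  have m0 : (0 < m)%R by rewrite ltr0n.
  (* A pattern through [v] is charged to every element of the class of [v] that lies in its set;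
     there is at least one, and its charge alone covers the weight. *)
  apply: le_trans (_ : \sum_(c in Fb)
    \sum_(s <- undup (cls v) | s \in Ac c) e / m * g s c <= _)%R.
    rewrite big_mkcondr /=; apply: ler_sum => c cF; case: ifP => [vc|_]; last first.
      by apply: sumr_ge0 => s _; rewrite mulr_ge0 // divr_ge0 // ltW.
    have [lt c1 _ _] := AcP c cF.
    move: vc; rewrite c1 inE => /mapP[s sA ev].
    have evs : eqv (val v) s.
      by have -> : val v = rep s := ev; rewrite eqv_sym eqv_rep.
    have sv : s \in undup (cls v) by rewrite mem_undup cls_spec.
    rewrite -c1 (big_rem s) //= sA.
    have := bound c s cF sA; rewrite -(size_cls evs) -/m => /le_trans; apply.
    by rewrite lerDl; apply: sumr_ge0 => s' _; rewrite mulr_ge0 // divr_ge0 // ltW.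
  rewrite (exchange_big_dep xpredT) //=.
  apply: le_trans (_ : \sum_(s <- undup (cls v)) e / m <= _)%R.
    apply: ler_sum => s _; rewrite -mulr_sumr -[leRHS]mulr1 ler_wpM2l //.
    by rewrite divr_ge0 // ltW.
  by rewrite big_const_seq count_predT iter_addr_0 -mulr_natr divfK // gt_eqF.
have ne0 c : c \in Fb -> c.1 != set0.
  move=> /AcP[lt c1 _ [Nn _]]; rewrite -cards_eq0 c1 card_support // -lt0n.
  exact: leq_ltn_trans Nn.
have [s sP] := avoiding_exists beta0 weight ne0.
exists (bits s) => A lt Nn H.
(* If the inequality failed on all of [A] for these bits, the trace of [s] on the support would
   itself be a forbidden pattern. *)
pose c := (support M A, s :&: support M A).
have agree : restrict (bits (s :&: support M A) \o rep) A = restrict (bits s \o rep) A.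
  apply/restrict_eq => a aA /=.
  pose i := Ordinal (lt a aA); have -> : rep a = i by [].
  have iA : i \in support M A by rewrite inE /= map_f.
  by rewrite !bitsE inE iA andbT.
have /sP : c \in Fb.
  rewrite inE; apply/asboolP; exists A; split=> //; first exact: subsetIr.
  by split=> // t tA /=; rewrite agree; exact: H.
by rewrite eqxx.
Qed.
End Patterns.

(** * Choice of the constants and conclusion *)

Lemma exists_expr_le (x e : R) :
  (0 < x -> x < 1 -> 0 < e -> exists n, x ^+ n.+1 <= e)%R.
Proof.
move=> x0 /RltP x1 /RltP e0.
have x0' : Rle 0 x by apply/RleP; exact: ltW.
have [|n nP] := pow_lt_1_zero x _ e e0; first by rewrite Rabs_pos_eq.
exists n; rewrite -RpowE; apply/RleP/Rlt_le; apply: Rle_lt_trans (nP n.+1 _).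
  exact: Rle_abs.
by apply/ssrnat.leP.
Qed.

Theorem theorem3
  (eqv : nat -> nat -> bool) (cls : nat -> seq nat)
  (eqv_refl : forall x, eqv x x)
  (eqv_sym : forall x y, eqv x y = eqv y x)
  (eqv_trans : forall x y z, eqv x y -> eqv y z -> eqv x z)
  (eqv_computable : exists c, forall x y, computes c (npair x y) (nat_of_bool (eqv x y)))
  (cls_spec : forall x y, (y \in cls x) = eqv x y)
  (cls_computable : exists c, forall x, computes c x (setcode (cls x)))
  (U : code) (HU : optimal_prefix_machine U)
  (gamma : R) (gamma_pos : Rlt (INR 0) gamma) (gamma_lt1 : Rlt gamma (INR 1)) :
  exists omega : nat -> bool, follows eqv omega /\
  exists N : nat, forall A : seq nat, N <= nfree eqv A ->
    exists t, t \in A /\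
      Rge (INR (K U (str2nat (restrict omega A)) t))
          (Rminus (Rminus (Rmult gamma (INR (nfree eqv A)))
                          (INR (K U (setcode A) t)))
                  (log2 (INR (size (undup (cls t)))))).
Proof.
pose q : R := exp (Rmult gamma (ln 2)).
have q0 : (0 < q)%R by apply/RltP; exact: exp_pos.
have q2 : (q < 2)%R.
  have two : (2%R : R) = IZR 2 by rewrite -INRE.
  rewrite two; apply/RltP; rewrite -[IZR 2]exp_ln; last Lra.lra.
  apply: exp_increasing.
  have ln2 : Rlt 0 (ln 2) by rewrite -ln_1; apply: ln_increasing; Lra.lra.
  have := Rmult_lt_compat_r _ _ _ ln2 gamma_lt1; rewrite /=; Lra.lra.
(* The midpoint between [q], which is 2^gamma, and 2. *)
pose beta : R := ((q + 2) / 2)%R.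
have qb : (q < beta)%R by rewrite /beta; lra.
have b2 : (beta < 2)%R by rewrite /beta; lra.
have b0 : (0 < beta)%R by exact: lt_trans qb.
(* [N] makes the total weight through a point fit the budget [2 - beta]. *)
have [N NP] : exists n, ((q / beta) ^+ n.+1 <= (2 - beta) / beta :> R)%R.
  apply: exists_expr_le; first exact: divr_gt0.
    by rewrite ltr_pdivrMr // mul1r.
  by rewrite divr_gt0 // subr_gt0.
have bN : (beta * (q / beta) ^+ N.+1 <= 2 - beta)%R.
  by move: NP; rewrite ler_pdivlMr // mulrC.
pose rp := rep eqv_refl.
(* The first [M] values of [w] decide [P M], and every finite [A] is covered by some [M]. *)
pose P M (w : nat -> bool) := forall A, (forall a, a \in A -> rp a < M) ->
    N < nfree eqv A ->
    ~ (forall t, t \in A ->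
        2 ^+ (K U (str2nat (restrict (w \o rp) A)) t + K U (setcode A) t)
          * (size (undup (cls t)))%:R < q ^+ nfree eqv A)%R.
have [w wP] : exists w, forall M, P M w.
  apply: compactness => [M w w' ww' Pw A lt|M].
    have -> : restrict (w' \o rp) A = restrict (w \o rp) A; last exact: Pw.
    by apply/restrict_eq => a aA /=; rewrite ww' // lt.
  have [w wP] := avoid_bounded eqv_refl eqv_sym eqv_trans cls_spec HU M q0 qb bN.
  by exists w => m le_m A lt; apply: wP => a /lt ltm; exact: leq_trans le_m.
exists (w \o rp); split.
  by move=> i j; rewrite (eqvE eqv_refl eqv_sym eqv_trans) /= => /eqP; rewrite -/rp => ->.
(* [P] concerns sets with strictly more than [N] free bits, hence the successor. *)
exists N.+1 => A NA; apply: contrapT => /forallNP H.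
apply: (wP (\max_(a <- A) rp a).+1 A) => // [a aA|t tA].
  by rewrite ltnS (leq_bigmax_seq (F := rp)).
apply: lt_bound_exp; last by move=> h; apply: (H t).
(* The class of [t] contains [t], so the argument of the logarithm is positive. *)
rewrite lt0n size_eq0; apply/eqP => e; have := cls_spec t t.
by rewrite -mem_undup e eqv_refl.
Qed.
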